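(* Let $\alpha,\beta,\rho$ be real numbers with $|\rho|<1$ and $|\beta\rho|<1$. Then the infinite series whose $n$th term ($n\ge1$) is $(\alpha+\alpha\beta+\cdots+\alpha\beta^{n-1})\rho^n$ converges, and its sum is $$\sum_{n=1}^{\infty}\left(\alpha+\alpha\beta+\cdots+\alpha\beta^{n-1}\right)\rho^n=\frac{\alpha\rho}{(1-\rho\beta)(1-\rho)}.$$ *)

(* Defs.v *)
From mathcomp Require Import all_boot all_order all_algebra.
From mathcomp Require Import reals.

Import GRing.Theory.
Local Open Scope ring_scope.

(* Meant for n >= 1; at n = 0 the inner sum is empty and the value is 0. *)
Definition geo_sum_term (R : realType) (alpha beta rho : R) (n : nat) : R :=
  (\sum_(0 <= k < n) alpha * beta ^+ k) * rho ^+ n.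

(* Main.v *)
Require Import Defs.
From mathcomp Require Import all_boot all_order all_algebra.
From mathcomp Require Import classical_sets reals topology normedtype sequences.
Import numFieldNormedType.Exports.
From mathcomp Require Import boolp ring lra.
Import Order.TTheory GRing.Theory Num.Theory.

Local Open Scope classical_set_scope.
Local Open Scope ring_scope.

(** The terms [u n = (alpha + ... + alpha * beta ^+ (n - 1)) * rho ^+ n] obey
    the first-order recurrence
      [u 0 = 0],  [u n.+1 = alpha * rho * rho ^+ n + beta * rho * u n],
    whose forcing term is geometric.  Summing the recurrence relates the partial
    sums of [u] to those of the geometric series and to themselves
    ([series_affine_rec]).  The analogous inequality between absolute values
    keeps the partial sums bounded, since [`|beta * rho| < 1]; the series
    therefore converges absolutely ([is_cvg_series_affine_rec]).  Passing to the
    limit in the identity shows that the sum [L] satisfies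
      [L = alpha * rho / (1 - rho) + beta * rho * L],
    which determines [L] ([cvg_series_affine_rec]).  This way the inner geometric
    sum is never put in closed form, and [beta = 1] needs no separate
    treatment. *)

Lemma series_affine_rec (R : realType) (q : R) (u v : R^nat) :
  u 0%N = 0 -> (forall n, u n.+1 = v n + q * u n) ->
  forall n, series u n.+1 = series v n + q * series u n.
Proof.
move=> u0 urec n.
rewrite /series /= big_nat_recl // u0 add0r mulr_sumr -big_split /=.
by apply: eq_bigr => i _; rewrite urec.
Qed.

(** If [V] bounds the partial sums of [`|v|], the recurrence propagates the bound
    [V / (1 - `|q|)], the fixed point of [x |-> V + `|q| * x], along the partial
    sums of [`|u|]. *)
Lemma is_cvg_series_affine_rec (R : realType) (q : R) (u v : R^nat) :
  `|q| < 1 -> u 0%N = 0 -> (forall n, u n.+1 = v n + q * u n) ->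
  cvgn [normed series v] -> cvgn (series u).
Proof.
move=> q1 u0 urec cv; apply: normed_cvg.
have ndv : nondecreasing_seq [normed series v].
  by apply: nondecreasing_series => i _ _; exact: normr_ge0.
have vle n := nondecreasing_cvgn_le ndv cv n.
set V := limn _ in vle.
have q1' : 0 < 1 - `|q| by rewrite subr_gt0.
have fixE : V / (1 - `|q|) = V + `|q| * (V / (1 - `|q|)).
  by field; rewrite gt_eqF.
apply: nondecreasing_is_cvgn.
  by apply: nondecreasing_series => i _ _; exact: normr_ge0.
exists (V / (1 - `|q|)) => _ [n _ <-].
elim: n => [|n IH].
  rewrite /normed_series_of /series /= big_geq // divr_ge0 ?(ltW q1') //.
  by have := vle 0%N; rewrite /normed_series_of /series /= big_geq.
rewrite fixE; apply: (@le_trans _ _ ([normed series v] n + `|q| * [normed series u] n)).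
  rewrite /normed_series_of /series /= big_nat_recl // u0 normr0 add0r mulr_sumr -big_split /=.
  by apply: ler_sum => i _; rewrite urec -normrM ler_normD.
by rewrite lerD // ler_wpM2l.
Qed.

Lemma cvg_series_affine_rec (R : realType) (q l : R) (u v : R^nat) :
  `|q| < 1 -> u 0%N = 0 -> (forall n, u n.+1 = v n + q * u n) ->
  cvgn [normed series v] -> series v @ \oo --> l ->
  series u @ \oo --> l / (1 - q).
Proof.
move=> q1 u0 urec cnv vl.
have cu : cvgn (series u) by exact: (@is_cvg_series_affine_rec R q u v).
set L := limn (series u).
have shiftL : (fun n => series u n.+1) @ \oo --> L by rewrite cvg_shiftS.
have recL : (fun n => series u n.+1) @ \oo --> l + q * L.
  rewrite (_ : (fun n => _) = (fun n => series v n + q * series u n)); last first.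
    by apply/funext => n; exact: series_affine_rec.
  by apply: cvgD => //; apply: cvgM => //; exact: cvg_cst.
have LE : L = l + q * L by exact: (cvg_unique _ shiftL recL).
have q1n : 1 - q != 0.
  by rewrite subr_eq0; apply: contraTneq q1 => <-; rewrite normr1 ltxx.
suff -> : l / (1 - q) = L by [].
by apply: (mulIf q1n); rewrite divfK //; lra.
Qed.

Lemma geo_sum_term_rec (R : realType) (alpha beta rho : R) (n : nat) :
  geo_sum_term R alpha beta rho n.+1 =
  geometric (alpha * rho) rho n + beta * rho * geo_sum_term R alpha beta rho n.
Proof.
rewrite /geo_sum_term /= big_nat_recl //= expr0 mulr1.
rewrite (_ : \sum_(0 <= i < n) alpha * beta ^+ i.+1 =
             beta * \sum_(0 <= i < n) alpha * beta ^+ i).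
  by rewrite exprS; ring.
by rewrite mulr_sumr; apply: eq_bigr => i _; rewrite exprS; ring.
Qed.

Theorem mainTheorem8 (R : realType) (alpha beta rho : R)
    (hrho : `|rho| < 1) (hbetarho : `|beta * rho| < 1) :
  cvgn (fun N : nat => \sum_(1 <= n < N) geo_sum_term R alpha beta rho n) /\
  \big[+%R/0]_(1 <= n <oo) geo_sum_term R alpha beta rho n
    = alpha * rho / ((1 - rho * beta) * (1 - rho)).
Proof.
set u := geo_sum_term R alpha beta rho.
have u0 : u 0%N = 0 by rewrite /u /geo_sum_term big_geq // mul0r.
(* The series starts at 1, while [series u] starts at 0, where [u] vanishes. *)
have sumE : (fun N => \sum_(1 <= n < N) u n) = series u.
  apply/funext => -[|N]; first by rewrite /series /= !big_geq.
  by rewrite /series /= [RHS]big_ltn // u0 add0r.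
have cng : cvgn [normed series (geometric (alpha * rho) rho)].
  have -> : [normed series (geometric (alpha * rho) rho)] =
            series (geometric `|alpha * rho| `|rho|).
    by congr (series _); apply/funext => n; rewrite /= normrM normrX.
  by apply: is_cvg_geometric_series; rewrite normr_id.
have ul := @cvg_series_affine_rec R _ _ u _ hbetarho u0
  (geo_sum_term_rec R alpha beta rho) cng (cvg_geometric_series hrho).
rewrite sumE; split; first by apply/cvg_ex; eexists; exact: ul.
rewrite (cvg_lim _ ul) //.
by rewrite (mulrC rho) invfM mulrA mulrAC.
Qed.
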